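(* Let $(A,\mathfrak{m})$ be an excellent normal local ring whose residue field $k=A/\mathfrak{m}$ is algebraically closed, and let $I\supsetneq J$ be $\mathfrak{m}$-primary integrally closed ideals of $A$. Then there exists an integrally closed ideal $I'$ of $A$ with $I\supset I'\supset J$ and $l_A(I/I')=1$.
   Context: $l_A(M)$ denotes the length of an $A$-module $M$. Local rings are Noetherian. The inclusions $I\supset I'\supset J$ in the conclusion are not required to be strict (so $I'=J$ is allowed). *)

(* Defs.v *)
From HB Require Import structures.
From mathcomp Require Import all_boot all_order all_algebra all_field.

Set Implicit Arguments.
Unset Strict Implicit.
Unset Printing Implicit Defensive.

Import GRing.Theory.

Local Open Scope ring_scope.
Local Open Scope quotient_scope.

Section Modules.
Variables (R : pzRingType) (V : lmodType R).

Section SubmoduleType.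
Variable N : submodClosed V.

Record submod_type := Submod { submod_val : V; _ : submod_val \in N }.

HB.instance Definition _ := [isSub for submod_val].
HB.instance Definition _ := [Choice of submod_type by <:].
HB.instance Definition _ := [SubChoice_isSubLmodule of submod_type by <:].
End SubmoduleType.

Section QuotientModule.
Variable N : submodClosed V.

(* The library's submodClosed does not record closure under opposites, which
   follows from scaling by -1 and is what the additive quotient expects. *)
Definition submod_pred : {pred V} := fun x => x \in N.

Lemma submod_pred_closed : submod_closed submod_pred.
Proof.
split=> [|a x y xN yN]; first exact: rpred0.
by apply: rpredD => //; apply: rpredZ.
Qed.

HB.instance Definition _ :=
  GRing.isSubmodClosed.Build R V submod_pred submod_pred_closed.

(* An alias of the additive quotient, so that it can carry the R-action. *)
Definition quot_mod := Quotient.quot submod_pred.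
HB.instance Definition _ := GRing.Zmodule.on quot_mod.

Definition quot_mod_pi (x : V) : quot_mod := \pi_(Quotient.quot submod_pred) x.

Definition quot_mod_scale (a : R) (x : quot_mod) : quot_mod :=
  quot_mod_pi (a *: repr (x : Quotient.quot submod_pred)).

Lemma quot_mod_piP (x y : V) : x - y \in submod_pred -> quot_mod_pi x = quot_mod_pi y.
Proof. by move=> xyN; apply/eqP; rewrite /quot_mod_pi piE Quotient.equivE. Qed.

Lemma quot_mod_piK (x : quot_mod) :
  quot_mod_pi (repr (x : Quotient.quot submod_pred)) = x.
Proof. exact: reprK. Qed.

Lemma quot_mod_repr (x : V) :
  repr (quot_mod_pi x : Quotient.quot submod_pred) - x \in submod_pred.
Proof. by rewrite Quotient.idealrBE reprK. Qed.

Lemma quot_mod_piD : {morph quot_mod_pi : x y / x + y}.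
Proof. by move=> x y; rewrite /quot_mod_pi raddfD. Qed.

Lemma quot_mod_scale_pi (a : R) (x : V) :
  quot_mod_scale a (quot_mod_pi x) = quot_mod_pi (a *: x).
Proof.
by apply: quot_mod_piP; rewrite -scalerBr; apply/rpredZ/quot_mod_repr.
Qed.

Lemma quot_mod_scaleA a b x :
  quot_mod_scale a (quot_mod_scale b x) = quot_mod_scale (a * b) x.
Proof.
by rewrite -[x]quot_mod_piK !quot_mod_scale_pi scalerA.
Qed.

Lemma quot_mod_scale1 : left_id 1 quot_mod_scale.
Proof.
by move=> x; rewrite -[x]quot_mod_piK quot_mod_scale_pi scale1r.
Qed.

Lemma quot_mod_scaleDr : right_distributive quot_mod_scale +%R.
Proof.
move=> a x y; rewrite -[x]quot_mod_piK -[y]quot_mod_piK.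
by rewrite -quot_mod_piD !quot_mod_scale_pi scalerDr quot_mod_piD.
Qed.

Lemma quot_mod_scaleDl x : {morph quot_mod_scale^~ x : a b / a + b}.
Proof.
move=> a b; rewrite -[x]quot_mod_piK.
by rewrite !quot_mod_scale_pi scalerDl quot_mod_piD.
Qed.

HB.instance Definition _ := GRing.Zmodule_isLmodule.Build R quot_mod
  quot_mod_scaleA quot_mod_scale1 quot_mod_scaleDr quot_mod_scaleDl.
End QuotientModule.

End Modules.

Section Subquotient.
Variables (R : pzRingType) (V : lmodType R) (N N' : submodClosed V).

Definition sub_restrict : {pred submod_type N} :=
  fun x => submod_val x \in N'.

Lemma sub_restrict_closed : submod_closed sub_restrict.
Proof.
split=> [|a x y xN' yN']; first exact: rpred0.
have E : submod_val (a *: x + y) = a *: submod_val x + submod_val y by [].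
by rewrite unfold_in /sub_restrict E; apply: rpredD => //; apply: rpredZ.
Qed.

HB.instance Definition _ :=
  GRing.isSubmodClosed.Build R (submod_type N) sub_restrict sub_restrict_closed.

(* The module N / N' (more generally N / (N :&: N') if N' is not inside N). *)
Definition subquot : lmodType R := quot_mod sub_restrict.
End Subquotient.

(* Strict inclusion of submodules. *)
Definition strict_sub (R : pzRingType) (V : lmodType R)
    (N N' : submodClosed V) : Prop :=
  {subset N <= N'} /\ ~ {subset N' <= N}.

(* l_R(M) = n, the length being the supremum of the lengths of strict chains
   of submodules of M. *)
Definition submod_chain (R : pzRingType) (M : lmodType R) (n : nat)
    (C : nat -> submodClosed M) : Prop :=
  forall i, (i < n)%N -> strict_sub (C i) (C i.+1).

Definition module_length (R : pzRingType) (M : lmodType R) (n : nat) : Prop :=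
  (exists C : nat -> submodClosed M, submod_chain n C) /\
  (forall n' (C : nat -> submodClosed M), submod_chain n' C -> (n' <= n)%N).

(* Ideals are the submodules of the regular module; the unit ideal is allowed,
   unlike in the library's idealr. *)
Notation ideal R := (submodClosed R^o).

Section Ideals.
Variable R : comPzRingType.
Implicit Types (I m p q : ideal R).

Definition prime_ideal p : Prop :=
  1 \notin p /\ forall x y : R, x * y \in p -> x \in p \/ y \in p.

Definition maximal_ideal m : Prop :=
  1 \notin m /\
  forall I, {subset m <= I} -> 1 \notin I -> {subset I <= m}.

Definition generated_by n (s : 'I_n -> R) I : Prop :=
  forall x : R, x \in I <-> exists c : 'I_n -> R, x = \sum_(i < n) c i * s i.

Definition noetherian : Prop :=
  forall I, exists n (s : 'I_n -> R), generated_by s I.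

Definition local_with m : Prop :=
  maximal_ideal m /\ forall m', maximal_ideal m' -> m' =i m.

(* x \in I ^ n; the coefficients c make I ^ 0 the unit ideal. *)
Definition in_ideal_pow I n (x : R) : Prop :=
  exists r (c : 'I_r -> R) (F : 'I_r -> 'I_n -> R),
    (forall i j, F i j \in I) /\ x = \sum_(i < r) c i * \prod_(j < n) F i j.

(* x ^ n + a_1 x ^ (n - 1) + ... + a_n = 0 with a_i \in I ^ i. *)
Definition integral_over_ideal I (x : R) : Prop :=
  exists n (a : nat -> R),
    [/\ (0 < n)%N,
        forall i, (0 < i <= n)%N -> in_ideal_pow I i (a i)
      & x ^+ n + \sum_(1 <= i < n.+1) a i * x ^+ (n - i) = 0].

Definition integrally_closed_ideal I : Prop :=
  forall x : R, integral_over_ideal I x -> x \in I.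

Definition primary_ideal I : Prop :=
  1 \notin I /\
  forall x y : R, x * y \in I -> x \notin I -> exists n, y ^+ n \in I.

Definition primary_to m I : Prop :=
  primary_ideal I /\ forall x : R, x \in m <-> exists n, x ^+ n \in I.

(* P 0 < P 1 < ... < P n. *)
Definition prime_chain n (P : nat -> ideal R) : Prop :=
  (forall i, (i <= n)%N -> prime_ideal (P i)) /\
  (forall i, (i < n)%N -> strict_sub (P i) (P i.+1)).

Definition krull_dim (d : nat) : Prop :=
  (exists P, prime_chain d P) /\ (forall n P, prime_chain n P -> (n <= d)%N).

Definition saturated_chain p q n (P : nat -> ideal R) : Prop :=
  [/\ prime_chain n P, P 0%N =i p, P n =i q
    & forall i r, (i < n)%N -> prime_ideal r ->
        ~ (strict_sub (P i) r /\ strict_sub r (P i.+1))].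

Definition catenary : Prop :=
  forall p q, prime_ideal p -> prime_ideal q -> {subset p <= q} ->
    (exists n P, saturated_chain p q n P) /\
    (forall n n' P P',
       saturated_chain p q n P -> saturated_chain p q n' P' -> n = n').

Definition regular_local_ring : Prop :=
  noetherian /\
  exists m d (s : 'I_d -> R),
    [/\ local_with m, krull_dim d & generated_by s m].

End Ideals.

(* The ring constructions below are described up to isomorphism. *)

(* f is the localization map R -> R_p. *)
Definition is_localization_at (R S : comPzRingType) (p : ideal R)
    (f : {rmorphism R -> S}) : Prop :=
  [/\ forall s : R, s \notin p -> exists t : S, f s * t = 1,
      forall x : S, exists (a s : R), s \notin p /\ x * f s = f a
    & forall a : R, f a = 0 <-> exists s : R, s \notin p /\ s * a = 0].

(* f is the canonical map from R to the field of fractions of R / p. *)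
Definition is_residue_field_at (R : comPzRingType) (K : fieldType)
    (p : ideal R) (f : {rmorphism R -> K}) : Prop :=
  (forall a : R, (a \in p) = (f a == 0)) /\
  (forall x : K, exists (a s : R), s \notin p /\ x = f a / f s).

(* f is the canonical map from R to the m-adic completion, i.e. to the inverse
   limit of the R / m ^ n; K n is the kernel of the projection to R / m ^ n. *)
Definition is_adic_completion (R C : comPzRingType) (m : ideal R)
    (f : {rmorphism R -> C}) : Prop :=
  exists K : nat -> ideal C,
    [/\ forall n, {subset K n.+1 <= K n},
        forall n (a : R), f a \in K n <-> in_ideal_pow m n a,
        forall n (c : C), exists a : R, c - f a \in K n,
        forall c : C, (forall n, c \in K n) -> c = 0
      & forall a : nat -> R,
          (forall n, in_ideal_pow m n (a n.+1 - a n)) ->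
          exists c : C, forall n, c - f (a n) \in K n].

(* T, with the maps i and j, is the tensor product B (x)_R C, i.e. the pushout
   of f and g in the category of commutative rings. *)
Definition is_tensor (R B C T : comPzRingType)
    (f : {rmorphism R -> B}) (g : {rmorphism R -> C})
    (i : {rmorphism B -> T}) (j : {rmorphism C -> T}) : Prop :=
  (forall x, i (f x) = j (g x)) /\
  forall (U : comPzRingType) (u : {rmorphism B -> U}) (v : {rmorphism C -> U}),
    (forall x, u (f x) = v (g x)) ->
    exists w : {rmorphism T -> U},
      [/\ forall b, w (i b) = u b, forall c, w (j c) = v c
        & forall w' : {rmorphism T -> U},
            (forall b, w' (i b) = u b) -> (forall c, w' (j c) = v c) ->
            w' =1 w].

Definition finite_type (R B : comPzRingType) (f : {rmorphism R -> B}) : Prop :=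
  exists s : seq B, forall S : subringClosed B,
    (forall a, f a \in S) -> {subset s <= S} -> forall b, b \in S.

Definition regular_at (R : comPzRingType) (p : ideal R) : Prop :=
  forall (S : comPzRingType) (f : {rmorphism R -> S}),
    is_localization_at p f -> regular_local_ring S.

Definition regular_ring (R : comPzRingType) : Prop :=
  noetherian R /\ forall p : ideal R, prime_ideal p -> regular_at p.

(* B (x)_K L is regular for every finite field extension L of K. *)
Definition geometrically_regular (K : fieldType) (B : comPzRingType)
    (f : {rmorphism K -> B}) : Prop :=
  forall (L : fieldExtType K) (T : comPzRingType)
      (i : {rmorphism B -> T}) (j : {rmorphism L -> T}),
    is_tensor f (in_alg L) i j -> regular_ring T.

(* For every prime p, the fibres of the completion map of R_p are
   geometrically regular; the completion map of a Noetherian local ring is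
   flat, so this says that the map is regular. *)
Definition G_ring (R : comPzRingType) : Prop :=
  forall (p : ideal R) (Rp : comPzRingType) (f : {rmorphism R -> Rp})
      (m : ideal Rp) (C : comPzRingType) (g : {rmorphism Rp -> C}),
    prime_ideal p -> is_localization_at p f -> local_with m ->
    is_adic_completion m g ->
  forall (q : ideal Rp) (K : fieldType) (h : {rmorphism Rp -> K})
      (B : comPzRingType) (i : {rmorphism K -> B}) (j : {rmorphism C -> B}),
    prime_ideal q -> is_residue_field_at q h -> is_tensor h g i j ->
    geometrically_regular i.

Definition regular_locus_open (R : comPzRingType) : Prop :=
  exists I : ideal R, forall p : ideal R, prime_ideal p ->
    (regular_at p <-> ~ {subset I <= p}).

Definition J2_ring (R : comPzRingType) : Prop :=
  forall (B : comPzRingType) (f : {rmorphism R -> B}),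
    finite_type f -> regular_locus_open B.

Definition universally_catenary (R : comPzRingType) : Prop :=
  forall (B : comPzRingType) (f : {rmorphism R -> B}),
    finite_type f -> catenary B.

Definition excellent (R : comPzRingType) : Prop :=
  [/\ noetherian R, G_ring R, J2_ring R & universally_catenary R].

(* A is integrally closed in its field of fractions. *)
Definition normal_domain (A : idomainType) : Prop :=
  forall z : {fraction A},
    integralOver (@tofrac A) z -> exists a : A, z = tofrac a.

(* Main.v *)
(* Choose x in I \ J. As x is not integral over J, the map A[J/x] -> k that is
   A -> k in degree 0 and kills J/x is well defined. By Zorn it extends to a
   maximal ring morphism from a subring V of Frac(A) to k, and since k is
   algebraically closed V is a valuation ring (Chevalley). Let y generate IV.
   Then I' is the kernel of the surjection I -> k sending f to the residue of
   f/y. It contains J because j/y = (j/x)(x/y), and dividing an equation of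
   integral dependence of f over I' by y ^ n shows that the residue of f/y is
   nilpotent, so I' is integrally closed. *)
From HB Require Import structures.
Require Import Defs.
From mathcomp Require Import all_boot all_order all_algebra all_field.
From mathcomp Require Import boolp classical_sets zify.

Set Implicit Arguments.
Unset Strict Implicit.
Unset Printing Implicit Defensive.

Import GRing.Theory.

Local Open Scope ring_scope.

(** * Subobjects given by predicates, and common roots of ideals of k[X] *)

Lemma subring_of_set (R : nzRingType) (X : set R) :
    X 1 -> (forall x y, X x -> X y -> X (x - y)) ->
    (forall x y, X x -> X y -> X (x * y)) ->
  exists S : subringClosed R, forall x, (x \in S) = `[< X x >].
Proof.
move=> X1 XB XM; pose P : {pred R} := fun x => `[< X x >].
have P_closed : subring_closed P.
  split=> [|x y|x y]; rewrite !unfold_in /P.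
  - exact/asboolP.
  - by move=> /asboolP Xx /asboolP Xy; apply/asboolP/XB.
  - by move=> /asboolP Xx /asboolP Xy; apply/asboolP/XM.
pose mixin := GRing.isSubringClosed.Build R P P_closed.
pose S : subringClosed R := HB.pack P mixin.
by exists S.
Qed.

Lemma submod_of_pred (R : pzRingType) (V : lmodType R) (P : {pred V}) :
  submod_closed P -> exists N : submodClosed V, N =i P.
Proof.
move=> P_closed; pose mixin := GRing.isSubmodClosed.Build R V P P_closed.
pose N : submodClosed V := HB.pack P mixin.
by exists N.
Qed.

(** By Euclidean division, a nonzero element of least size divides all the others; it is not
    constant because [Q] is proper, so it has a root. *)
Lemma closed_ideal_root (k : fieldType) (Q : {poly k} -> Prop) :
    GRing.closed_field_axiom k ->
    Q 0 -> (forall f g, Q f -> Q g -> Q (f - g)) ->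
    (forall f g, Q g -> Q (f * g)) -> ~ Q 1 ->
  exists c, forall f, Q f -> root f c.
Proof.
move=> k_closed Q0 QB QM Q1.
have [[n [g [Qg g0 size_g]]]|Qall0] :=
    pselect (exists n g, [/\ Q g, g != 0 & size g = n]); last first.
  exists 0 => f Qf; have [->|f0] := eqVneq f 0; first exact: root0.
  by case: Qall0; exists (size f), f.
pose P n := `[< exists g, [/\ Q g, g != 0 & size g = n] >].
have exP : exists n, P n by exists n; apply/asboolP; exists g.
case: (ex_minnP exP) => {n g Qg g0 size_g exP} _ /asboolP[g [Qg g0 <-]] g_min.
have size_g : size g != 1.
  apply/negP=> /size_poly1P[c c0 gE]; apply: Q1.
  by rewrite -polyC1 -(mulVf c0) polyCM -gE; apply: QM.
have /(PreClosedField.closed_rootP k_closed)[c gc] := size_g.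
exists c => f Qf; suff /eqP fg0 : f %% g == 0.
  by rewrite (divp_eq f g) fg0 addr0 rootM gc orbT.
apply: contraT => fg0; have := ltn_modp f g; rewrite g0 ltnNge.
rewrite g_min //; apply/asboolP; exists (f %% g); split=> //.
have -> : f %% g = f - (f %/ g) * g by rewrite {2}(divp_eq f g) addrC addKr.
by apply: QB => //; apply: QM.
Qed.

(** * Maximal places and Chevalley's theorem *)

Section Places.
Variables K k : fieldType.
Implicit Types (S T : subringClosed (K * k)%type) (z w : K) (c d : k).

(* A subring of K x k in which (0, c) occurs only for c = 0 is the graph of a
   ring morphism from a subring of K to k. *)
Definition functional S := forall c, (0, c) \in S -> c = 0.

Definition maximal_place S :=
  functional S /\ forall T, functional T -> {subset S <= T} -> {subset T <= S}.

Lemma maximal_place_exists S0 : functional S0 ->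
  exists2 S, maximal_place S & {subset S0 <= S}.
Proof.
move=> S0_fun; pose G0 : set (K * k) := [set p | p \in S0]%classic.
(* Zorn's lemma also covers the empty chain, whose union is empty; the guard admits the empty set,
   which is not maximal since the graph of [S0] is larger. *)
pose place (X : set (K * k)) := (X !=set0)%classic ->
  [/\ (G0 `<=` X)%classic,
      forall p q, X p -> X q -> X (p - q),
      forall p q, X p -> X q -> X (p * q)
    & forall c, X (0, c) -> c = 0].
have place_of_subring S :
    functional S -> {subset S0 <= S} -> place [set p | p \in S]%classic.
  move=> S_fun S0S _; split=> [p /S0S //|p q|p q|] /=; last exact: S_fun.
  - exact: rpredB.
  - exact: rpredM.
have [F F_place F_tot|X [X_place X_max]] := @Zorn_bigcup _ place.
  case=> p [X FX Xp]; have X_ne : (X !=set0)%classic by exists p.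
  have [G0X _ _ _] := F_place X FX X_ne.
  have common q r : (\bigcup_(Y in F) Y)%classic q ->
      (\bigcup_(Y in F) Y)%classic r -> exists Y, [/\ F Y, Y q & Y r].
    move=> [Y FY Yq] [Z FZ Zr]; have [YZ|ZY] := F_tot Y Z FY FZ.
      by exists Z; split=> //; apply: YZ.
    by exists Y; split=> //; apply: ZY.
  split=> [q /G0X Xq|q r Fq Fr|q r Fq Fr|c [Y FY Y0c]]; first by exists X.
  - have [Y [FY Yq Yr]] := common q r Fq Fr.
    have [_ YB _ _] := F_place Y FY (ex_intro _ q Yq).
    by exists Y => //; apply: YB.
  - have [Y [FY Yq Yr]] := common q r Fq Fr.
    have [_ _ YM _] := F_place Y FY (ex_intro _ q Yq).
    by exists Y => //; apply: YM.
  - by have [_ _ _] := F_place Y FY (ex_intro _ _ Y0c); apply.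
have X_ne : (X !=set0)%classic.
  apply: contrapT => /set0P/negP/negPn/eqP X0.
  have /X_max[] : (X `<` G0)%classic.
    by rewrite X0 properEneq; split=> //; apply/eqP => /seteqP[_ /(_ 1)];
       rewrite /G0 /= => /(_ (rpred1 S0)).
  exact: place_of_subring.
have [G0X XB XM X0] := X_place X_ne.
have [S SX] := subring_of_set (G0X 1 (rpred1 S0)) XB XM.
have XS p : X p <-> p \in S by rewrite SX; split=> /asboolP.
exists S; last by move=> p /G0X/XS.
split=> [c /XS|T T_fun ST p Tp]; first exact: X0.
apply: contrapT => Sp; apply: (X_max [set q | q \in T]%classic).
  split=> [q /XS/ST //|/(_ p Tp)/XS //].
by apply: place_of_subring => // q /G0X/XS/ST.
Qed.

Lemma horner_pair (f : {poly K * k}) z c :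
  f.[(z, c)] = ((map_poly fst f).[z], (map_poly snd f).[c]).
Proof.
by apply: injective_projections; rewrite -[in LHS]horner_map.
Qed.

Lemma horner_rev n (p : {poly K}) z : (size p <= n.+1)%N -> z != 0 ->
  (\poly_(i < n.+1) p`_(n - i)).[z] = z ^+ n * p.[z^-1].
Proof.
move=> size_p z0; rewrite horner_poly (horner_coef_wide _ size_p) mulr_sumr.
rewrite (reindex_inj rev_ord_inj) /=; apply: eq_bigr => i _; rewrite subSS.
have le_in : (i <= n)%N by rewrite -ltnS.
by rewrite subKn // mulrCA expfB_cond ?(negPf z0) //= ?exprVn.
Qed.

Section Maximal.
Hypothesis k_closed : GRing.closed_field_axiom k.
Variable S : subringClosed (K * k)%type.
Hypothesis S_max : maximal_place S.
Hypothesis S_surj : forall c, exists z, (z, c) \in S.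

Definition finite_at z := exists c, (z, c) \in S.

(** With V the domain of the place and n the kernel of its residue map, such an [f] says that 1 lies
    in n V[z]: the obstruction to giving [z] a residue. *)
Definition root_witness z (f : {poly K * k}) :=
  [/\ f \is a polyOver S, root (map_poly fst f) z & map_poly snd f = 1].

(** Without a witness, the residues of the polynomials over [S] that vanish at [z] form a proper
    ideal of k[X]. A common root [c] is a consistent residue for [z], and maximality puts [(z, c)]
    in [S]. *)
Lemma finite_or_root_witness z : finite_at z \/ exists f, root_witness z f.
Proof.
have [|noroot] := pselect (exists f, root_witness z f); [by right | left].
pose Q (g : {poly k}) := exists f : {poly K * k},
  [/\ f \is a polyOver S, root (map_poly fst f) z & map_poly snd f = g].
have [| | | |c Qc] := closed_ideal_root k_closed (Q := Q).
- by exists 0; rewrite !rmorph0 rpred0 root0.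
- move=> _ _ [f [Sf fz <-]] [g [Sg gz <-]]; exists (f - g).
  split; rewrite ?rmorphB ?rpredB //.
  by rewrite /root hornerD hornerN (eqP fz) (eqP gz) subrr.
- move=> g _ [f [Sf fz <-]].
  (* Lifting the coefficients of [g] to [S] makes [Q] stable under multiplication by all of k[X]. *)
  have [h Sh hg] : exists2 h : {poly K * k}, h \is a polyOver S & map_poly snd h = g.
    pose z_of c := sval (cid (S_surj c)).
    exists (\poly_(i < size g) (z_of g`_i, g`_i)).
      apply/polyOverP => i; rewrite coef_poly; case: ifP => _; last exact: rpred0.
      by rewrite /z_of; case: cid.
    apply/polyP => i; rewrite coef_map coef_poly /=; case: ltnP => //= gi.
    by rewrite nth_default.
  exists (h * f); split; first exact: rpredM.
  - by rewrite rmorphM rootM fz orbT.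
  - by rewrite rmorphM /= hg.
- by case=> f; apply: contra_not noroot; exists f.
have [_ S_max'] := S_max.
(* [X] is the subring generated by [S] and [(z, c)]; it is functional because a polynomial vanishing
   at [z] has its residue in [Q]. *)
pose X p := exists2 f : {poly K * k}, f \is a polyOver S & p = f.[(z, c)].
have [| | |T TX] := @subring_of_set (K * k)%type X.
- by exists 1; rewrite ?rpred1 ?hornerC.
- by move=> _ _ [f Sf ->] [g Sg ->]; exists (f - g); rewrite ?rpredB ?hornerD ?hornerN.
- by move=> _ _ [f Sf ->] [g Sg ->]; exists (f * g); rewrite ?rpredM ?hornerM.
exists c; apply: (S_max' T) => [d|p Sp|]; rewrite TX.
- case/asboolP => f Sf; rewrite horner_pair => -[/esym/eqP fz ->].
  by apply/eqP/Qc; exists f.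
- by apply/asboolP; exists p%:P; rewrite ?polyOverC ?hornerC.
- by apply/asboolP; exists 'X; rewrite ?polyOverX ?hornerX.
Qed.

(** Chevalley's descent: the shorter witness, reversed, cancels the leading term of the longer one
    and leaves a smaller witness. *)
Lemma root_witness_absurd z f h : z != 0 ->
  root_witness z f -> root_witness z^-1 h -> False.
Proof.
have [S_fun _] := S_max.
have coef2 f' w : root_witness w f' -> forall i, (f'`_i).2 = (i == 0%N)%:R.
  by case=> _ _ f1 i; rewrite -coef1 -f1 coef_map.
move: {2}(size f + size h)%N (leqnn (size f + size h)) => N.
elim: N z f h => [|N IH] z f h le_N z0 fz hz.
  have := coef2 _ _ fz 0%N; rewrite nth_default /=; last by case: (size f) le_N.
  by move/eqP; rewrite eq_sym oner_eq0.
wlog le_hf : z f h le_N z0 fz hz / (size h <= size f)%N.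
  move=> wlog; have [|/ltnW] := leqP (size h) (size f); first exact: (wlog z f h).
  by apply: (wlog z^-1 h f); rewrite ?invrK ?invr_eq0 // addnC.
have [Sf rf f1] := fz; have [Sh rh h1] := hz.
case size_f: (size f) => [|[|n]].
- have := coef2 _ _ fz 0%N; rewrite nth_default ?size_f //=.
  by move/eqP; rewrite eq_sym oner_eq0.
(* A constant witness would be the pair [(0, 1)], which a functional [S] excludes. *)
- have fE : f = (f`_0)%:P by apply: size1_polyC; rewrite size_f.
  move: rf; rewrite fE map_polyC rootC /= => /eqP f01.
  have : f`_0 \in S by apply: (polyOverP Sf).
  rewrite [f`_0]surjective_pairing f01 => /S_fun.
  by rewrite (coef2 _ _ fz) => /eqP; rewrite oner_eq0.
case size_h: (size h) => [|l].
  have := coef2 _ _ hz 0%N; rewrite nth_default ?size_h //=.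
  by move/eqP; rewrite eq_sym oner_eq0.
have le_ln : (l <= n.+1)%N by rewrite -ltnS -size_f -size_h.
(* [rev_h] is X^l h(1/X), so it vanishes at [z]; the shift below brings it to the degree of [f]. The
   residue of [f'] is again 1, since the constant coefficient of [h] has residue 1 and the leading
   one of [f] has residue 0. *)
pose rev_h := \poly_(i < l.+1) h`_(l - i).
pose f' := h`_0 *: f - f`_n.+1 *: (rev_h * 'X^(n.+1 - l)).
have size_f' : (size f' <= n.+1)%N.
  apply/leq_sizeP => i le_ni; rewrite coefB !coefZ coefMXn coef_poly.
  have -> : (i < n.+1 - l)%N = false by lia.
  move: le_ni; rewrite leq_eqVlt => /predU1P[<-|lt_ni].
    have -> : (n.+1 - (n.+1 - l) = l)%N by lia.
    by rewrite ltnSn subnn mulrC subrr.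
  have -> : (i - (n.+1 - l) < l.+1)%N = false by lia.
  by rewrite (@nth_default _ 0 f i) ?size_f // !mulr0 subr0.
have rev_hz : (map_poly fst rev_h).[z] = 0.
  have -> : map_poly fst rev_h = \poly_(i < l.+1) (map_poly fst h)`_(l - i).
    apply/polyP => i; rewrite coef_map [in LHS]coef_poly [RHS]coef_poly coef_map.
    by case: ifP.
  rewrite horner_rev // ?(eqP rh) ?mulr0 //.
  by rewrite -size_h; apply: size_poly.
have Sc (p : {poly K * k}) i : p \is a polyOver S -> p`_i \in S by move/polyOverP.
have Srev_h : rev_h \is a polyOver S.
  apply/polyOverP => i; rewrite coef_poly; case: ifP => _; first exact: Sc.
  exact: rpred0.
apply: (IH z f' h _ z0 _ hz); first by lia.
rewrite /f' -!mul_polyC; split.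
- by rewrite rpredB ?rpredM ?polyOverC ?Sc ?rpredX ?polyOverX.
- rewrite /root rmorphB !rmorphM /= !map_polyC hornerD hornerN !hornerM.
  by rewrite (eqP rf) rev_hz !mul0r !mulr0 subr0.
- rewrite rmorphB !rmorphM /= !map_polyC /= (coef2 _ _ hz) (coef2 _ _ fz) f1.
  by rewrite mul0r subr0 mulr1.
Qed.
End Maximal.
End Places.

(** * Calculus with powers of an ideal *)

Section IdealPowers.
Variable R : comPzRingType.
Implicit Types (I J : ideal R) (x y : R).

Lemma in_ideal_pow_prod I n (c : R) (F : 'I_n -> R) :
  (forall j, F j \in I) -> in_ideal_pow I n (c * \prod_(j < n) F j).
Proof.
by move=> IF; exists 1%N, (fun=> c), (fun=> F); split=> //; rewrite big_ord1.
Qed.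

Lemma in_ideal_powD I n x y :
  in_ideal_pow I n x -> in_ideal_pow I n y -> in_ideal_pow I n (x + y).
Proof.
move=> [r [c [F [IF ->]]]] [s [d [G [IG ->]]]].
exists (r + s)%N, (fun i => match split i with inl j => c j | inr j => d j end).
exists (fun i => match split i with inl j => F j | inr j => G j end).
split=> [i j|]; first by case: split.
rewrite big_split_ord /=; congr (_ + _); apply: eq_bigr => i _.
- by have := unsplitK (inl i : 'I_r + 'I_s); rewrite /= => ->.
- by have := unsplitK (inr i : 'I_r + 'I_s); rewrite /= => ->.
Qed.

Lemma in_ideal_pow_sum_ind (P : R -> Prop) I n :
    P 0 -> (forall x y, P x -> P y -> P (x + y)) ->
    (forall (c : R) (F : 'I_n -> R), (forall j, F j \in I) ->
       P (c * \prod_(j < n) F j)) ->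
  forall x, in_ideal_pow I n x -> P x.
Proof.
by move=> P0 PD PM _ [r [c [F [IF ->]]]]; apply: big_ind => // i _; apply: PM.
Qed.

Lemma in_ideal_pow_0r I n : in_ideal_pow I n 0.
Proof.
by exists 0%N, (fun=> 0), (fun _ _ => 0); split=> [[]//|]; rewrite big_ord0.
Qed.

Lemma in_ideal_powZ I n a x : in_ideal_pow I n x -> in_ideal_pow I n (a * x).
Proof.
apply: (in_ideal_pow_sum_ind (P := fun y => in_ideal_pow I n (a * y))).
- by rewrite mulr0; apply: in_ideal_pow_0r.
- by move=> y z Iy Iz; rewrite mulrDr; apply: in_ideal_powD.
- by move=> c F IF; rewrite mulrA; apply: in_ideal_pow_prod.
Qed.

Lemma in_ideal_powB I n x y :
  in_ideal_pow I n x -> in_ideal_pow I n y -> in_ideal_pow I n (x - y).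
Proof.
by move=> Ix Iy; rewrite -mulN1r; apply/in_ideal_powD/in_ideal_powZ.
Qed.

Lemma in_ideal_powM I n p x y :
  in_ideal_pow I n x -> in_ideal_pow I p y -> in_ideal_pow I (n + p) (x * y).
Proof.
move=> Ix Iy; move: x Ix; apply: in_ideal_pow_sum_ind.
- by rewrite mul0r; apply: in_ideal_pow_0r.
- by move=> x z Ix Iz; rewrite mulrDl; apply: in_ideal_powD.
move=> c F IF; move: y Iy; apply: in_ideal_pow_sum_ind.
- by rewrite mulr0; apply: in_ideal_pow_0r.
- by move=> x z Ix Iz; rewrite mulrDr; apply: in_ideal_powD.
move=> d G IG; pose H (i : 'I_(n + p)) :=
  match split i with inl j => F j | inr j => G j end.
suff -> : c * \prod_(j < n) F j * (d * \prod_(j < p) G j) =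
    c * d * \prod_(i < n + p) H i.
  by apply: in_ideal_pow_prod => i; rewrite /H; case: split.
rewrite big_split_ord /= mulrACA; congr (_ * (_ * _)); apply: eq_bigr => i _.
- by have := unsplitK (inl i : 'I_n + 'I_p); rewrite /H /= => ->.
- by have := unsplitK (inr i : 'I_n + 'I_p); rewrite /H /= => ->.
Qed.

Lemma in_ideal_pow0 I x : in_ideal_pow I 0 x.
Proof.
have F0 : 'I_0 -> R by case.
have := @in_ideal_pow_prod I 0 x F0; rewrite big_ord0 mulr1; apply.
by case.
Qed.

Lemma in_ideal_pow1 I x : x \in I -> in_ideal_pow I 1 x.
Proof.
by move=> Ix; have := @in_ideal_pow_prod I 1 1 (fun=> x); rewrite big_ord1 mul1r; apply.
Qed.

Lemma integral_over_ideal_sub I J x :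
  {subset I <= J} -> integral_over_ideal I x -> integral_over_ideal J x.
Proof.
move=> IJ [n [a [n0 Ia xE]]]; exists n, a; split=> // i /Ia.
move=> [r [c [F [IF ->]]]]; exists r, c, F; split=> // i' j; exact: IJ.
Qed.

End IdealPowers.

(** * Subquotients of length one *)

(** The hypotheses make [V] simple: in a chain C 0 < C 1 < C 2, an element of C 1 outside C 0 is
    nonzero, so it generates [V] and C 1 is already everything. *)
Lemma module_length1 (R : pzRingType) (V : lmodType R) (u0 : V) :
    u0 != 0 -> (forall u v : V, u != 0 -> exists a : R, v = a *: u) ->
  module_length V 1.
Proof.
move=> u0_neq0 span.
have [N0 N0E] : exists N : submodClosed V, N =i pred1 0.
  apply: submod_of_pred; split=> [|a u v]; rewrite !inE //.
  by move=> /eqP-> /eqP->; rewrite scaler0 addr0.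
have [N1 N1E] : exists N : submodClosed V, N =i predT.
  by apply: submod_of_pred.
split.
  exists (fun i => if i is 0%N then N0 else N1) => -[|//] _.
  split=> [u _|/(_ u0)]; first by rewrite N1E.
  by rewrite N1E N0E inE => /(_ isT); apply/negP.
move=> n C chain; rewrite leqNgt; apply/negP => n1.
have [_ C10] := chain 0%N (ltnW n1).
have [_ C21] := chain 1%N n1.
apply: C21 => v _; apply: contrapT => C1v.
apply: C10 => u C1u; apply: contrapT => C0u.
have u_neq0 : u != 0 by apply/eqP => u0E; apply: C0u; rewrite u0E rpred0.
have [a vE] := span u v u_neq0.
by apply: C1v; rewrite vE rpredZ.
Qed.

Lemma quot_mod_pi_eq0 (R : pzRingType) (V : lmodType R) (N : submodClosed V)
  (x : V) : (quot_mod_pi N x == 0) = (x \in N).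
Proof.
have -> : 0 = quot_mod_pi N 0 by rewrite /quot_mod_pi raddf0.
by rewrite -[in RHS](subr0 x) /quot_mod_pi piE Quotient.equivE.
Qed.

Lemma subquot_length1 (R : comPzRingType) (I I' : ideal R) (x : R) :
    x \in I -> x \notin I' ->
    (forall f g, f \in I -> f \notin I' -> g \in I ->
       exists a : R, g - a * f \in I') ->
  module_length (subquot I I') 1.
Proof.
move=> Ix I'x span.
pose cl (f : submod_type I) : subquot I I' := quot_mod_pi (sub_restrict I') f.
have clK u : exists f, u = cl f.
  by exists (repr (u : Quotient.quot _)); rewrite /cl quot_mod_piK.
have cl0 f : (cl f == 0) = (submod_val f \in I').
  exact: quot_mod_pi_eq0.
apply: (@module_length1 _ _ (cl (Submod Ix))); first by rewrite cl0.
move=> u v; have [[f If] ->] := clK u; have [[g Ig] ->] := clK v.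
rewrite cl0 /= => I'f; have [a I'gf] := span f g If I'f Ig.
exists a; rewrite [RHS]quot_mod_scale_pi.
exact: quot_mod_piP.
Qed.

(** * The ring A[J/x] and its residue map to k *)

Section ReesPlace.
Variables (A : comNzRingType) (K k : fieldType).
Variables (iota : {rmorphism A -> K}) (pi : {rmorphism A -> k}).
Hypothesis iota_inj : injective iota.
Variables (J : ideal A) (x : A).

(** Multiplying f(1/x) = 0 by a power of x gives a monic equation for x. *)
Lemma integral_of_horner (f : {poly A}) :
    x != 0 -> (forall i, in_ideal_pow J i f`_i) -> f`_0 = 1 ->
    root (map_poly iota f) (iota x)^-1 ->
  integral_over_ideal J x.
Proof.
(* The exponent is [size f] rather than the degree, so it is positive even for a constant [f]; the
   coefficient at that index is 0. *)
move=> x0 Jf f0 fx; exists (size f), (fun i => f`_i); split.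
- rewrite lt0n size_poly_eq0; apply/eqP => fE; move: f0; rewrite fE coef0.
  by move/eqP; rewrite eq_sym oner_eq0.
- by move=> i _; apply: Jf.
have ix0 : iota x != 0 by rewrite raddf_eq0.
apply: iota_inj; rewrite rmorph0.
have size_f : (size (map_poly iota f) <= (size f).+1)%N.
  by apply: leq_trans (leqnSn _); apply: size_poly.
transitivity (iota x ^+ size f * (map_poly iota f).[(iota x)^-1]); last first.
  by rewrite (eqP fx) mulr0.
rewrite (horner_coef_wide _ size_f) big_ord_recl coef_map /= f0 rmorph1 mul1r.
rewrite mulrDr mulr1 mulr_sumr big_add1 /= big_mkord rmorphD rmorphXn rmorph_sum.
congr (_ + _); apply: eq_bigr => i _; rewrite coef_map rmorphM rmorphXn /=.
by rewrite mulrCA expfB_cond ?(negPf ix0) ?exprVn // add0n ltn_ord.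
Qed.

(** Polynomials with i-th coefficient in J^i form the Rees algebra, which evaluation at 1/x maps
    onto A[J/x]. One that vanishes at 1/x with nonzero residue could be normalised to constant
    coefficient 1, making x integral over J. *)
Lemma rees_place :
    (forall c, exists a, pi a = c) ->
    (forall a, pi a = 0 -> exists n, a ^+ n \in J) ->
    x != 0 -> ~ integral_over_ideal J x ->
  exists S : subringClosed (K * k)%type,
    [/\ functional S, forall a, (iota a, pi a) \in S
      & forall j, j \in J -> (iota j / iota x, 0) \in S].
Proof.
move=> pi_surj pi_ker x0 xJ.
have ix0 : iota x != 0 by rewrite raddf_eq0.
pose X (p : K * k) := exists2 f : {poly A}, forall i, in_ideal_pow J i f`_i &
  p = ((map_poly iota f).[(iota x)^-1], pi f`_0).
have [| | |S SX] := @subring_of_set (K * k)%type X.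
- exists 1 => [i|]; last by rewrite coef1 !rmorph1 hornerC.
  by rewrite coef1; case: i => [|i]; [apply: in_ideal_pow0 | apply: in_ideal_pow_0r].
- move=> _ _ [f Jf ->] [g Jg ->]; exists (f - g) => [i|].
    by rewrite coefB; apply: in_ideal_powB.
  by rewrite coefB !rmorphB hornerD hornerN.
- move=> _ _ [f Jf ->] [g Jg ->]; exists (f * g) => [i|].
    rewrite coefM; elim/big_ind: _ => [|y z|j _].
    + exact: in_ideal_pow_0r.
    + exact: in_ideal_powD.
    + by rewrite -{1}(subnKC (ltn_ord j : (j <= i)%N)); apply: in_ideal_powM.
  by rewrite coefM big_ord1 subnn !rmorphM hornerM.
exists S; split=> [c|a|j Jj]; rewrite SX.
- case/asboolP => f Jf [/esym/eqP fx cE]; apply: contrapT => /eqP c0.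
  apply: xJ; have [v piv] := pi_surj c^-1.
  have [|n Jn] := pi_ker (1 - v * f`_0).
    by rewrite rmorphB rmorphM rmorph1 piv -cE mulVf ?subrr.
  set u := 1 - v * f`_0 in Jn.
  (* The geometric sum improves [v], an inverse of the constant coefficient of [f] modulo the kernel
     of [pi], to an inverse modulo [J]. *)
  pose w := v * \sum_(i < n) u ^+ i.
  have uE : u ^+ n = 1 - w * f`_0.
    have u1 : u - 1 = - (v * f`_0) by rewrite addrC addKr.
    by rewrite -[u ^+ n](subrK 1) subrX1 u1 addrC mulNr mulrAC.
  (* 1 - x X vanishes at 1/x and u ^+ n lies in J, so this correction makes the
     constant coefficient equal to 1 and keeps the i-th one in J ^ i. *)
  apply: (@integral_of_horner (w *: f + u ^+ n *: (1 - x *: 'X))) => // [i||].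
  + rewrite coefD !coefZ; apply: in_ideal_powD; first exact: in_ideal_powZ.
    rewrite coefB coefZ coef1 coefX; case: i => [|[|i]].
    * exact: in_ideal_pow0.
    * by rewrite mulrC; apply/in_ideal_powZ/in_ideal_pow1.
    * by rewrite mulr0 subr0 mulr0; apply: in_ideal_pow_0r.
  + by rewrite coefD !coefZ coefB coefZ coef1 coefX mulr0 subr0 mulr1 uE addrC subrK.
  + rewrite /root rmorphD /= !map_polyZ rmorphB /= map_polyZ map_polyX rmorph1.
    rewrite hornerD !hornerZ hornerD hornerN hornerZ hornerX hornerC (eqP fx).
    by rewrite divff // subrr !mulr0 addr0.
- apply/asboolP; exists a%:P; last by rewrite coefC map_polyC hornerC.
  move=> i; rewrite coefC; case: i => [|i]; first exact: in_ideal_pow0.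
  exact: in_ideal_pow_0r.
- apply/asboolP; exists (j *: 'X).
    move=> [|[|i]]; rewrite coefZ coefX ?mulr0 ?mulr1.
    + exact: in_ideal_pow_0r.
    + exact: in_ideal_pow1.
    + exact: in_ideal_pow_0r.
  by rewrite coefZ coefX mulr0 rmorph0 map_polyZ map_polyX hornerZ hornerX.
Qed.

End ReesPlace.

(** * Elements of least value and the residue kernel *)

(** Divisibility is total in a valuation ring, so induction on the list compares its head with the
    best entry of its tail. *)
Lemma minimal_value (K k : fieldType) (S : subringClosed (K * k)%type) (s : seq K) :
    GRing.closed_field_axiom k -> maximal_place S ->
    (forall c, exists z, (z, c) \in S) ->
    has (predC1 0) s ->
  exists y, [/\ y \in s, y != 0 & forall w, w \in s -> finite_at S (w / y)].
Proof.
move=> k_closed S_max S_surj.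
(* Witnesses for both [z] and its inverse are contradictory, so the domain of [S] is a valuation
   ring. *)
have total z : z != 0 -> finite_at S z \/ finite_at S z^-1.
  move=> z0; have [|[f fz]] := finite_or_root_witness k_closed S_max S_surj z.
    by left.
  have [|[h hz]] := finite_or_root_witness k_closed S_max S_surj z^-1.
    by right.
  by case: (root_witness_absurd S_max z0 fz hz).
have finiteM z w : finite_at S z -> finite_at S w -> finite_at S (z * w).
  by move=> [c Sc] [d Sd]; exists (c * d); apply: (rpredM Sc Sd).
have finite0 : finite_at S 0 by exists 0; apply: rpred0.
have finite1 : finite_at S 1 by exists 1; apply: rpred1.
elim: s => [|w s IH] //= ; have [->|w0] /= := eqVneq w 0.
  move=> /IH[y [sy y0 y_min]]; exists y; rewrite inE sy orbT; split=> // z.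
  by rewrite inE => /predU1P[->|/y_min //]; rewrite mul0r.
move=> _; have [/IH[y [sy y0 y_min]]|s0] := boolP (has (predC1 0) s); last first.
  exists w; rewrite inE eqxx; split=> // z; rewrite inE => /predU1P[->|sz].
    by rewrite divff.
  by move/hasPn: s0 => /(_ z sz); rewrite /= negbK => /eqP->; rewrite mul0r.
have [wy|yw] : finite_at S (w / y) \/ finite_at S (w / y)^-1.
- by apply: total; rewrite mulf_neq0 ?invr_eq0.
- exists y; rewrite inE sy orbT; split=> // z.
  by rewrite inE => /predU1P[->|/y_min].
(* Here y/w is finite, hence so is z/w = (z/y)(y/w). *)
- exists w; rewrite inE eqxx; split=> // z; rewrite inE => /predU1P[->|/y_min zy].
    by rewrite divff.
  by have := finiteM _ _ zy yw; rewrite invf_div mulrA divfK.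
Qed.

(** The residue of f/y is A-linear in f and is 1 at f = y; this gives an ideal with simple
    quotient. *)
Lemma residue_kernel_ideal (A : comNzRingType) (K k : fieldType)
    (iota : {rmorphism A -> K}) (pi : {rmorphism A -> k})
    (S : subringClosed (K * k)%type) (I : ideal A) (y : A) :
    (forall c, exists a, pi a = c) ->
    functional S -> (forall a, (iota a, pi a) \in S) ->
    integrally_closed_ideal I -> y \in I -> iota y != 0 ->
    (forall f, f \in I -> finite_at S (iota f / iota y)) ->
  exists I' : ideal A,
    [/\ forall f, (f \in I') = (f \in I) && ((iota f / iota y, 0) \in S),
        integrally_closed_ideal I' & module_length (subquot I I') 1].
Proof.
move=> pi_surj S_fun SA I_closed Iy iy0 SI.
pose P : {pred A^o} := fun f => (f \in I) && ((iota f / iota y, 0) \in S).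
have [I' I'E] : exists I' : ideal A, I' =i P.
  apply: submod_of_pred; split=> [|a f g].
    by apply/andP; rewrite rmorph0 mul0r; split; apply: rpred0.
  move=> /andP[If Sf] /andP[Ig Sg]; apply/andP; split.
    by apply: rpredD => //; apply: rpredZ.
  have := rpredD (rpredM (SA a) Sf) Sg.
  rewrite [X in X \in S]surjective_pairing /= mulr0 addr0 mulrA -mulrDl.
  by rewrite rmorphD rmorphM.
(* The second component is 1 for the empty product and 0 otherwise. *)
have S_prod j (F : 'I_j -> A) : (forall i, F i \in I') ->
    (iota (\prod_(i < j) F i) / iota y ^+ j, (j == 0%N)%:R) \in S.
  elim: j F => [|j IH] F I'F.
    by rewrite big_ord0 rmorph1 divr1 rpred1.
  have /andP[_ SF0] : P (F ord0) by have := I'F ord0; rewrite I'E.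
  have := rpredM SF0 (IH _ (fun i => I'F (lift ord0 i))).
  rewrite [X in X \in S]surjective_pairing /= mul0r mulrACA -invfM -exprS.
  by rewrite big_ord_recl rmorphM.
have S_pow j : (0 < j)%N -> forall a, in_ideal_pow I' j a ->
    (iota a / iota y ^+ j, 0) \in S.
  move=> j0; apply: in_ideal_pow_sum_ind => [|a b Sa Sb|c F I'F].
  - by rewrite rmorph0 mul0r rpred0.
  - have := rpredD Sa Sb.
    by rewrite [X in X \in S]surjective_pairing /= addr0 -mulrDl rmorphD.
  - have := rpredM (SA c) (S_prod j F I'F).
    rewrite [X in X \in S]surjective_pairing /= mulrA -rmorphM.
    by rewrite eqn0Ngt j0 mulr0.
exists I'; split; first exact: I'E.
- move=> f fI'.
  have If : f \in I.
    apply/I_closed/(integral_over_ideal_sub _ fI') => g; rewrite I'E.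
    by case/andP.
  rewrite I'E; apply/andP; split=> //; have [c Sc] := SI f If.
  have [p [a [p0 aI' fE]]] := fI'.
  pose q : K * k := (iota f / iota y, c).
  (* [r] is the equation of dependence divided by y^p, read in K and k at once: its components are 0
     and c^p, so functionality forces c = 0. *)
  pose r := q ^+ p + \sum_(1 <= i < p.+1) (iota (a i) / iota y ^+ i, 0) * q ^+ (p - i).
  have Sr : r \in S.
    rewrite rpredD ?rpredX // big_nat_cond rpred_sum // => i.
    rewrite andbT => /andP[lt_0i lt_ip]; rewrite rpredM ?rpredX // S_pow //.
    by apply: aI'; rewrite lt_0i.
  have r1 : fst r = 0.
    rewrite -(mul0r (iota y ^+ p)^-1) -(rmorph0 iota) -fE /r.
    rewrite (rmorphD iota) rmorphXn (rmorph_sum iota) mulrDl mulr_suml.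
    rewrite -expr_div_n.
    rewrite rmorphD rmorphXn rmorph_sum /=; congr (_ + _).
    apply: eq_big_nat => i /andP[_ lt_ip]; rewrite !rmorphM !rmorphXn /=.
    by rewrite expr_div_n mulrACA -invfM -exprD subnKC.
  have r2 : snd r = c ^+ p.
    rewrite /r rmorphD rmorphXn rmorph_sum /= big1 ?addr0 // => i _.
    by rewrite mul0r.
  move: Sr; rewrite [r]surjective_pairing r1 r2 => /S_fun/eqP.
  by rewrite expf_eq0 p0 => /eqP c0; rewrite -c0.
- apply: (@subquot_length1 _ _ _ y) => //.
    rewrite I'E; apply/negP => /andP[_]; rewrite divff // => S10.
    have := rpredB (rpred1 S) S10.
    rewrite [X in X \in S]surjective_pairing /= subrr subr0 => /S_fun/eqP.
    by rewrite oner_eq0.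
  move=> f g If I'f Ig; have [c Sf] := SI f If; have [d Sg] := SI g Ig.
  have c0 : c != 0.
    by apply: contraNneq I'f => c0; rewrite I'E; apply/andP; rewrite -c0.
  (* With c and d the residues of f/y and g/y, any [a] above d/c makes the residue of (g - a f)/y
     vanish. *)
  have [a pia] := pi_surj (d / c); exists a; rewrite I'E; apply/andP; split.
    by rewrite -mulNr; apply: rpredD => //; apply: (rpredZ (- a) If).
  have := rpredB Sg (rpredM (SA a) Sf).
  rewrite [X in X \in S]surjective_pairing /= pia divfK // subrr mulrA -mulrBl.
  by rewrite rmorphB rmorphM.
Qed.

(** * Application to the fraction field of A *)

Theorem theorem2p1 (A : idomainType) (m : ideal A)
    (k : fieldType) (pi : {rmorphism A -> k})
    (A_noetherian : noetherian A) (A_local : local_with m)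
    (A_normal : normal_domain A) (A_excellent : excellent A)
    (pi_surj : forall x : k, exists a : A, pi a = x)
    (pi_ker : forall a : A, (a \in m) = (pi a == 0))
    (k_closed : GRing.closed_field_axiom k)
    (I J : ideal A) (JI : strict_sub J I)
    (I_primary : primary_to m I) (J_primary : primary_to m J)
    (I_closed : integrally_closed_ideal I)
    (J_closed : integrally_closed_ideal J) :
  exists I' : ideal A,
    [/\ integrally_closed_ideal I', {subset I' <= I}, {subset J <= I'}
      & module_length (subquot I I') 1].
Proof.
have [sJI nIJ] := JI.
have [x Ix Jx] : exists2 x : A, x \in I & x \notin J.
  apply: contrapT => no_x; apply: nIJ => x Ix; apply: contrapT => /negP Jx.
  by apply: no_x; exists x.
have x0 : x != 0 by apply: contraNneq Jx => ->; apply: rpred0.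
have xJ : ~ integral_over_ideal J x by move/J_closed; apply/negP.
have [K [iota iota_inj]] : exists (K : fieldType) (iota : {rmorphism A -> K}),
    injective iota.
  exists {fraction A}, (@tofrac A) => a b /eqP; rewrite tofrac_eq.
  by move/eqP.
have [|S0 [S0_fun S0A S0J]] := rees_place iota_inj pi_surj _ x0 xJ.
  (* The kernel of [pi] is [m], the radical of [J]. *)
  by move=> a /eqP; rewrite -pi_ker => /(proj2 J_primary).
have [S S_max S0S] := maximal_place_exists S0_fun.
have SA a : (iota a, pi a) \in S := S0S _ (S0A a).
have S_surj c : exists z, (z, c) \in S.
  by have [a <-] := pi_surj c; exists (iota a).
have [n [s sI]] := A_noetherian I.
(* A generator of [I] of least value is chosen; not all generators are zero because [x] is a nonzero
   combination of them. *)
have [_ [/codomP[i0 ->] iy0 y_min]] : exists y,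
    [/\ y \in codom (fun i => iota (s i)), y != 0
    & forall w, w \in codom (fun i => iota (s i)) -> finite_at S (w / y)].
  apply: minimal_value => //; apply/hasP => /=.
  have [c xE] := (sI x).1 Ix.
  apply: contrapT => s0; move/eqP: x0; apply; rewrite xE big1 // => i _.
  apply/eqP; rewrite mulf_eq0; apply/orP; right.
  rewrite -[_ == 0](raddf_eq0 _ iota_inj).
  by apply: contrapT => /negP si0; apply: s0; exists (iota (s i)); rewrite ?codom_f.
set y := s i0 in iy0 y_min.
have Iy : y \in I.
  apply/sI; exists (fun i => (i == i0)%:R).
  by rewrite (bigD1 i0) //= eqxx mul1r big1 ?addr0 // => i /negPf->; rewrite mul0r.
(* Finiteness passes from the generators to all of [I], since elements of [A] have residues given by
   [pi]. *)
have SI f : f \in I -> finite_at S (iota f / iota y).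
  case/sI => c ->; rewrite rmorph_sum mulr_suml.
  elim/big_ind: _ => [|z w [d Sd] [e Se]|i _].
  - by exists 0; apply: rpred0.
  - by exists (d + e); apply: (rpredD Sd Se).
  have [d Sd] := y_min _ (codom_f _ i); exists (pi (c i) * d).
  by rewrite rmorphM -mulrA; apply: (rpredM (SA (c i)) Sd).
have [I' [I'E I'_closed I'_len]] :=
  residue_kernel_ideal pi_surj S_max.1 SA I_closed Iy iy0 SI.
exists I'; split=> // [f|j Jj]; first by rewrite I'E => /andP[].
rewrite I'E; apply/andP; split; first exact: sJI.
have [c Sc] := SI x Ix; have := rpredM (S0S _ (S0J j Jj)) Sc.
rewrite [X in X \in S]surjective_pairing /= mul0r mulrA divfK //.
by rewrite raddf_eq0.
Qed.
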